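(* Suppose that for every non-constant polynomial $P \in \mathbb{Z}[x]$, $$\limsup_{x,y \geq 2} \frac{\Psi_P(x,y)\,\log y}{y} = \infty,$$ i.e. the quantity $\Psi_P(x,y)\log y / y$ is unbounded as $(x,y)$ ranges over real numbers $x,y \ge 2$. Then for every algebraic number $\alpha$ the set $\mathbb{N}+\alpha = \{n+\alpha : n \in \mathbb{N}\}$ is multiplicatively dependent. In particular, there is no algebraic number $\alpha$ for which $\mathbb{N}+\alpha$ is multiplicatively independent.
   Context: Here $\mathbb{N} = \{n \in \mathbb{Z} : n \ge 0\}$. For a polynomial $P \in \mathbb{Z}[x]$ and real $x,y\ge 2$, $\Psi_P(x,y)$ denotes the number of integers in the set $\{P(n) : 1 \le n < x\}$ all of whose prime factors are less than or equal to $y$. A set $M \subset \mathbb{C}$ is multiplicatively dependent if there exist distinct $x_1,\ldots,x_n \in M$ and integers $k_1,\ldots,k_n$, not all zero, with $\prod_{j=1}^n x_j^{k_j} = 1$; otherwise $M$ is multiplicatively independent. *)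

(* Defs.v *)
From HB Require Import structures.
From mathcomp Require Import all_boot all_order all_algebra finmap complex.
From mathcomp Require Import all_classical all_reals all_analysis.

Set Implicit Arguments.
Unset Strict Implicit.
Unset Printing Implicit Defensive.

Import Order.TTheory GRing.Theory Num.Theory.
Local Open Scope classical_set_scope.
Local Open Scope ring_scope.
Local Open Scope complex_scope.

(* 0 is divisible by every prime, so it is never y-smooth; the sign of m is
   irrelevant. *)
Definition smooth {R : realType} (y : R) (m : int) : Prop :=
  forall p : nat, prime p -> (p%:Z %| m)%Z -> p%:R <= y.

Definition poly_values {R : realType} (P : {poly int}) (x : R) : set int :=
  [set P.[n%:Z] | n in [set n : nat | (1 <= n)%N /\ n%:R < x]].

Definition smooth_values {R : realType} (P : {poly int}) (x y : R) : set int :=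
  poly_values P x `&` [set m | smooth y m].

(* fset_set is only meaningful on finite sets. *)
Lemma finite_smooth_values (R : realType) (P : {poly int}) (x y : R) :
  finite_set (smooth_values P x y).
Proof.
apply: finite_setIl; apply: finite_image.
apply: (sub_finite_set _ (finite_II (Num.truncn x).+1)) => n [_ nx] /=.
by rewrite -(ltr_nat R); apply: lt_trans nx (truncnS_gt x).
Qed.

Definition Psi {R : realType} (P : {poly int}) (x y : R) : nat :=
  #|` fset_set (smooth_values P x y)|%fset.

Definition multiplicatively_dependent {R : realType} (M : set R[i]) : Prop :=
  exists (n : nat) (x : 'I_n -> R[i]) (k : 'I_n -> int),
    [/\ injective x,
        forall j, M (x j),
        exists j, k j <> 0 &
        \prod_(j < n) x j ^ k j = 1].

Definition multiplicatively_independent {R : realType} (M : set R[i]) : Prop :=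
  ~ multiplicatively_dependent M.

Definition algebraic_number {R : realType} (alpha : R[i]) : Prop :=
  algebraicOver (@ratr R[i]) alpha.

Definition nat_translate {R : realType} (alpha : R[i]) : set R[i] :=
  [set n%:R + alpha | n in [set: nat]].

(* Main.v *)
Require Import Defs.
From HB Require Import structures.
From mathcomp Require Import all_boot all_order all_algebra finmap complex.
From mathcomp Require Import all_classical all_reals all_analysis.
From mathcomp Require Import ring lra zify.
Import Order.TTheory GRing.Theory Num.Theory.
Set Implicit Arguments.
Unset Strict Implicit.
Unset Printing Implicit Defensive.
Local Open Scope classical_set_scope.
Local Open Scope ring_scope.
Local Open Scope complex_scope.

(** Let g in Z[X] have degree d, leading coefficient c and roots alpha = r_1,
    ..., r_d in C, and put P = g(-X).  By Chebyshev's bound the hypothesis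
    yields N integers n, with P(n) y-smooth and nonzero, where N > d #S + d and
    S is the set of primes that are at most y or divide c.

    For every prime p, Chevalley's theorem gives a valuation ring A_p of C in
    which p is not invertible.  If p is not in S, every n + r_i is a unit of
    A_p.  If p is in S, then (n + r_i)^(d!) is a power p^k times a unit of A_p.
    The d #S exponents k and the d numbers d! ln |n + r_i| attach to every n a
    vector with fewer than N entries, so by the pigeonhole principle there are
    arbitrarily many exponent vectors f whose quotients
    b_i = prod_n (n + r_i)^(d! (f(n) - f0(n))) are units of all the A_p and
    have modulus at most e.  The b_i are the eigenvalues of a rational matrix
    (a polynomial in the companion matrix of g), whose characteristic
    polynomial then has integral coefficients, because a rational number in
    all the A_p is an integer, and these are bounded independently of f.
    Thus b_1 takes finitely many values, and two vectors f with the same b_1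
    give a multiplicative relation between the n + alpha.  This replaces both
    the ideal theory of Q(alpha) and Dirichlet's unit theorem. *)

(** * Chebyshev's upper bound *)

Lemma prod_distinct_primes_dvd (s : seq nat) (m : nat) :
  uniq s -> (forall p, p \in s -> prime p) -> (forall p, p \in s -> p %| m)%N ->
  (\prod_(p <- s) p %| m)%N.
Proof.
elim: s => [|p s IH] /=; first by rewrite big_nil dvd1n.
move=> /andP[ps us] prs dvs; rewrite big_cons Gauss_dvd.
  rewrite dvs ?mem_head //=; apply: IH => // q qs.
    by apply: prs; rewrite inE qs orbT.
  by apply: dvs; rewrite inE qs orbT.
rewrite big_seq; elim/big_ind: _ => [|x y cx cy|q qs]; first exact: coprimen1.
  by rewrite coprimeMr cx.
have pp : prime p by apply: prs; rewrite mem_head.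
rewrite prime_coprime // dvdn_prime2 //; last by apply: prs; rewrite inE qs orbT.
by apply: contraNneq ps => ->.
Qed.

Lemma bin_leq_exp2 n k : ('C(n, k) <= 2 ^ n)%N.
Proof.
have [kn|nk] := leqP k n; last by rewrite bin_small.
rewrite -[2%N]/(1 + 1)%N expnDn (bigD1 (inord k)) //= inordK //.
by rewrite !exp1n !muln1 leq_addr.
Qed.

Lemma prime_dvd_fact_leq p m : prime p -> (p %| m`!)%N -> (p <= m)%N.
Proof.
move=> pp; elim: m => [|m IH]; first by rewrite fact0 Euclid_dvd1.
rewrite factS Euclid_dvdM // => /orP[|/IH/leqW//]; exact: dvdn_leq.
Qed.

(** The prime p divides n! but neither k! nor (n - k)!, both being factorials of numbers below p. *)
Lemma prime_dvd_bin p n k : prime p -> (k <= n - k < p)%N -> (p <= n)%N ->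
  (p %| 'C(n, k))%N.
Proof.
move=> pp /andP[knk nkp] pn.
have kn : (k <= n)%N by lia.
have : (p %| n`!)%N by rewrite dvdn_fact // prime_gt0.
rewrite -(bin_fact kn) Euclid_dvdM // Euclid_dvdM // => /orP[//|/orP[]].
  by move/(prime_dvd_fact_leq pp); lia.
by move/(prime_dvd_fact_leq pp); lia.
Qed.

(** Induction after Erdős: with k = n / 2 rounded down, the product of the primes in (n - k, n]
    divides C(n, k) <= 2 ^ n. The base 8 closes the induction because 3 (n - k) + n <= 3 n amounts
    to n <= 3 k, true from n = 2 on. *)
Lemma primorial_leq n : (\prod_(0 <= p < n.+1 | prime p) p <= 8 ^ n)%N.
Proof.
elim/ltn_ind: n => n IH; have [n1|n1] := leqP n 1.
  by move: n n1 {IH}; do 2?case=> //; rewrite unlock.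
pose k := n./2.
have kn : (k <= n)%N by rewrite /k; lia.
rewrite (@big_cat_nat _ _ _ (n - k).+1) //=; last by rewrite ltnS leq_subr.
have hl : (\prod_(0 <= p < (n - k).+1 | prime p) p <= 8 ^ (n - k))%N.
  by apply: IH; rewrite /k; lia.
have hr : (\prod_((n - k).+1 <= p < n.+1 | prime p) p <= 2 ^ n)%N.
  apply: leq_trans (bin_leq_exp2 n k); apply: dvdn_leq; first by rewrite bin_gt0.
  rewrite -big_filter; apply: prod_distinct_primes_dvd.
  - by rewrite filter_uniq // iota_uniq.
  - by move=> p; rewrite mem_filter => /andP[].
  - move=> p; rewrite mem_filter mem_index_iota => /and3P[pp lo hi].
    by apply: prime_dvd_bin => //; rewrite /k in lo hi *; lia.
apply: leq_trans (leq_mul hl hr) _.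
have -> : (8 = 2 ^ 3)%N by [].
by rewrite -!expnM -expnD leq_pexp2l // /k; lia.
Qed.

Definition prime_count (n : nat) : nat := count prime (iota 0 n.+1).

Lemma prod_primes_ln (R : realType) (n : nat) :
  \sum_(0 <= p < n.+1 | prime p) ln (p%:R : R) <= n%:R * ln 8.
Proof.
have gt0 : (0 < \prod_(0 <= p < n.+1 | prime p) p)%N.
  by rewrite prodn_cond_gt0 // => p /prime_gt0.
have -> : \sum_(0 <= p < n.+1 | prime p) ln (p%:R : R) =
    ln (\prod_(0 <= p < n.+1 | prime p) p)%N%:R.
  suff [] : (0 < \prod_(0 <= p < n.+1 | prime p) p)%N /\
    \sum_(0 <= p < n.+1 | prime p) ln (p%:R : R) =
    ln (\prod_(0 <= p < n.+1 | prime p) p)%N%:R by [].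
  elim/big_ind2: _ => [|x y z t [y0 ->] [t0 ->]|p pp]; first by rewrite ln1.
    by rewrite muln_gt0 y0 t0 natrM lnM // posrE ltr0n.
  by rewrite prime_gt0.
rewrite mulr_natl -lnXn // ler_ln ?posrE ?ltr0n ?exprn_gt0 //.
by rewrite -natrX ler_nat primorial_leq.
Qed.

(* The primes below sqrt y are at most sqrt y in number, the others each
   contribute at least (ln y) / 2 to the sum of the logarithms. *)
Lemma chebyshev_upper (R : realType) (y : R) : 2 <= y ->
  (prime_count (Num.truncn y))%:R * ln y <= (2 + 2 * ln 8) * y.
Proof.
move=> y2; set n := Num.truncn y.
have y0 : 0 < y by lra.
have ny : n%:R <= y by rewrite truncn_le ltW.
have ln0 : 0 <= ln y by apply: ln_ge0; lra.
pose r := Num.sqrt y.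
have r0 : 0 < r by rewrite sqrtr_gt0.
have rr : r ^+ 2 = y by rewrite sqr_sqrtr // ltW.
have lnr : ln y = 2 * ln r by rewrite -rr lnXn // mulr_natl.
pose small := count (fun p => prime p && (p%:R <= r)) (iota 0 n.+1).
pose large := count (fun p => prime p && ~~ (p%:R <= r)) (iota 0 n.+1).
have split : prime_count n = (small + large)%N.
  rewrite /prime_count /small /large -count_predUI.
  rewrite [X in (_ + X)%N](_ : _ = 0%N).
    by rewrite addn0; apply: eq_count => p /=; case: prime => //=; case: (_ <= r).
  apply/eqP; rewrite -leqn0 leqNgt -has_count; apply/hasPn => p _ /=.
  by case: prime => //=; case: (_ <= r).
have smallr : small%:R <= r.
  apply: (@le_trans _ _ (Num.truncn r)%:R); last by rewrite truncn_le ltW.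
  rewrite ler_nat /small -size_filter.
  rewrite -[X in (_ <= X)%N](size_iota 1); apply: uniq_leq_size.
    by rewrite filter_uniq // iota_uniq.
  move=> p; rewrite mem_filter mem_iota => /andP[/andP[pp pr] _].
  by rewrite mem_iota prime_gt0 //= add1n ltnS truncn_ge_nat // ltW.
have largel : large%:R * ln r <= y * ln 8.
  apply: (@le_trans _ _ (n%:R * ln 8)); last by rewrite ler_wpM2r // ln_ge0; lra.
  apply: le_trans (prod_primes_ln R n).
  rewrite [X in _ <= X](bigID (fun p => p%:R <= r)) /=.
  apply: (@le_trans _ _
      (\sum_(0 <= p < n.+1 | prime p && ~~ (p%:R <= r)) ln (p%:R : R))).
    rewrite /large -sum1_count natr_sum mulr_suml.
    apply: ler_sum => p /andP[pp]; rewrite -ltNge => rp; rewrite mul1r.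
    by rewrite ler_ln ?posrE ?ltr0n ?prime_gt0 // ltW.
  rewrite lerDr; apply: sumr_ge0 => p /andP[pp _]; apply: ln_ge0.
  by rewrite ler1n prime_gt0.
rewrite split natrD mulrDl.
have lr := ln_sublinear r0.
(* Here ln y = 2 ln r with ln r <= r, and r ^ 2 = y. *)
have : small%:R * ln y <= 2 * y.
  rewrite -rr [in leLHS]rr lnr; apply: (@le_trans _ _ (r * (2 * ln r))).
    by rewrite ler_wpM2r // -lnr.
  by nra.
move: largel; rewrite lnr; lra.
Qed.

(** * Valuation rings *)

Definition subring (F : nzRingType) (A : set F) : Prop :=
  [/\ A 1, forall x y, A x -> A y -> A (x - y) &
      forall x y, A x -> A y -> A (x * y)].

Section Subring.
Variables (F : nzRingType) (A : set F).
Hypothesis subA : subring A.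

Lemma subring1 : A 1. Proof. by case: subA. Qed.

Lemma subringB x y : A x -> A y -> A (x - y).
Proof. by case: subA => _ + _; exact. Qed.

Lemma subringM x y : A x -> A y -> A (x * y).
Proof. by case: subA => _ _; exact. Qed.

Lemma subring0 : A 0.
Proof. by rewrite -(subrr 1); apply: subringB; exact: subring1. Qed.

Lemma subringN x : A x -> A (- x).
Proof. by rewrite -sub0r; apply: subringB; exact: subring0. Qed.

Lemma subringD x y : A x -> A y -> A (x + y).
Proof. by move=> Ax Ay; rewrite -[y]opprK; apply/subringB/subringN. Qed.

Lemma subringX x n : A x -> A (x ^+ n).
Proof.
move=> Ax; elim: n => [|n IH]; first by rewrite expr0; exact: subring1.
by rewrite exprS; exact: subringM.
Qed.

Lemma subring_sum (I : Type) (r : seq I) (P : pred I) (f : I -> F) :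
  (forall i, P i -> A (f i)) -> A (\sum_(i <- r | P i) f i).
Proof.
by move=> Af; elim/big_ind: _ => //; [exact: subring0|exact: subringD].
Qed.

Lemma subring_nat n : A n%:R.
Proof.
elim: n => [|n IH]; first exact: subring0.
by rewrite -natr1; apply: subringD => //; exact: subring1.
Qed.

Lemma subring_int z : A z%:~R.
Proof.
by case: z => n; rewrite ?NegzE ?mulrNz; [|apply: subringN]; exact: subring_nat.
Qed.

End Subring.

Section Adjoin.
Variables (F : fieldType) (A : set F).
Hypothesis subA : subring A.

Definition adjoin (x : F) : set F :=
  [set z | exists q : {poly F}, (forall i, A q`_i) /\ z = q.[x]].

Lemma adjoin_subring x : subring (adjoin x).
Proof.
split.
- exists 1; split; last by rewrite hornerC.
  by move=> i; rewrite coef1; exact: subring_nat.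
- move=> _ _ [q [Aq ->]] [r [Ar ->]]; exists (q - r); split.
    by move=> i; rewrite coefB; exact: subringB.
  by rewrite !hornerE.
- move=> _ _ [q [Aq ->]] [r [Ar ->]]; exists (q * r); split.
    move=> i; rewrite coefM; apply: subring_sum => // j _; exact: subringM.
  by rewrite hornerM.
Qed.

Lemma sub_adjoin x : A `<=` adjoin x.
Proof.
move=> a Aa; exists a%:P; split; last by rewrite hornerC.
by move=> i; rewrite coefC; case: ifP => // _; exact: subring0.
Qed.

Lemma adjoin_id x : adjoin x x.
Proof.
exists 'X; split; last by rewrite hornerX.
by move=> i; rewrite coefX; exact: subring_nat.
Qed.

(** The part of [adjoin] of degree at most n; the descent in Chevalley's theorem runs on n. *)
Definition pspan (n : nat) (x : F) : set F :=
  [set z | exists u : nat -> F,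
    (forall i, A (u i)) /\ z = \sum_(i < n.+1) u i * x ^+ i].

Lemma pspanD n x y z : pspan n x y -> pspan n x z -> pspan n x (y + z).
Proof.
move=> [u [Au ->]] [v [Av ->]]; exists (fun i => u i + v i); split.
  by move=> i; exact: subringD.
by rewrite -big_split; apply: eq_bigr => i _; rewrite mulrDl.
Qed.

Lemma pspan_scale n x a i : A a -> (i <= n)%N -> pspan n x (a * x ^+ i).
Proof.
move=> Aa ilen; exists (fun j => if j == i then a else 0); split.
  by move=> j; case: ifP => // _; exact: subring0.
rewrite (bigD1 (inord i)) //= inordK // eqxx big1 ?addr0 // => j.
rewrite -val_eqE /= inordK // => /negPf ->; by rewrite mul0r.
Qed.

Lemma pspan_sum n x (I : Type) (r : seq I) (P : pred I) (f : I -> F) :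
  (forall i, P i -> pspan n x (f i)) -> pspan n x (\sum_(i <- r | P i) f i).
Proof.
move=> h; elim/big_ind: _ => //; last exact: pspanD.
by rewrite -(mul0r (x ^+ 0)); apply: pspan_scale => //; exact: subring0.
Qed.

Lemma adjoin_pspan x z : adjoin x z -> exists n, pspan n x z.
Proof.
move=> [q [Aq ->]]; exists (size q); apply: (ex_intro _ (fun i => q`_i)).
by split=> //; exact: horner_coef_wide.
Qed.

Lemma pspan0 x z : pspan 0 x z -> A z.
Proof. by move=> [u [Au ->]]; rewrite big_ord_recl big_ord0 addr0 mulr1. Qed.

End Adjoin.

Lemma exprV_mul_expr (F : fieldType) (x : F) (i n : nat) :
  x != 0 -> (i <= n)%N -> x^-1 ^+ i * x ^+ n = x ^+ (n - i).
Proof.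
move=> x0 ilen; rewrite -{1}(subnK ilen) exprD mulrCA exprVn.
by rewrite mulVf ?expf_neq0 // mulr1.
Qed.

(** * Chevalley's theorem *)

Section Chevalley.
Variables (F : fieldType) (B : set F) (a : F).
Hypotheses (subB : subring B) (Ba : B a) (a0 : a != 0) (Ba1 : ~ B a^-1).

Lemma maximal_subring_avoiding_inverse : exists A : set F,
  [/\ subring A, B `<=` A, ~ A a^-1 &
      forall A', subring A' -> A `<=` A' -> ~ A' a^-1 -> A' = A].
Proof.
pose P := [set X : set F | ~ X a^-1 /\ (X = set0 \/ (B `<=` X /\ subring X))].
have [|A [[nA [A0|[BA subA]]] maxA]] := @Zorn_bigcup _ P.
- move=> G GP Gtot; split; first by move=> [X GX Xa]; have [] := GP _ GX.
  have [[X [GX X0]]|none] := pselect (exists X, G X /\ X <> set0); last first.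
    left; apply/seteqP; split=> // z [X GX Xz]; apply: none; exists X; split=> //.
    by move=> X0; rewrite X0 in Xz.
  right; have [_ [//|[BX [X1 _ _]]]] := GP _ GX.
  have two op : (forall Z, subring Z -> forall x y, Z x -> Z y -> Z (op x y)) ->
      forall x y, (\bigcup_(Z in G) Z) x -> (\bigcup_(Z in G) Z) y ->
      (\bigcup_(Z in G) Z) (op x y).
    move=> hop x y [Y GY Yx] [Z GZ Zy].
    have subG W w : G W -> W w -> subring W.
      by move=> GW Ww; have [_ [W0|[]//]] := GP _ GW; rewrite W0 in Ww.
    have [YZ|ZY] := Gtot _ _ GY GZ.
      by exists Z => //; exact: (hop _ (subG _ _ GZ Zy) _ _ (YZ _ Yx) Zy).
    by exists Y => //; exact: (hop _ (subG _ _ GY Yx) _ _ Yx (ZY _ Zy)).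
  split; first by move=> z Bz; exists X => //; exact: BX.
  split; first by exists X.
    by apply: (two (fun x y => x - y)) => Z hZ x y; exact: subringB.
  by apply: (two (fun x y => x * y)) => Z hZ x y; exact: subringM.
- exfalso; apply: (maxA B); last first.
    by split=> //; right; split.
  rewrite A0; split => [z []|BA]; exact: BA Ba.
- exists A; split=> // A' subA' AA' nA'.
  apply: contrapT => neq; apply: (maxA A').
    split=> // A'A; apply: neq; exact/seteqP.
  by split=> //; right; split=> //; exact: subset_trans AA'.
Qed.

(** Take A maximal among the subrings that contain B and avoid a^-1. If x and x^-1 are both outside
    A, then A[x] and A[x^-1] contain a^-1 by maximality, and the two expressions of a^-1 reduce each
    other until one has degree 0, which puts a^-1 in A. *)
Lemma chevalley_valuation_ring : exists A : set F,
  [/\ subring A, B `<=` A, ~ A a^-1 & forall x, A x \/ A x^-1].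
Proof.
have [A [subA BA nA maxA]] := maximal_subring_avoiding_inverse.
have Aa := BA _ Ba.
have mem x : ~ adjoin A x a^-1 -> A x.
  move=> h; have <- := maxA _ (adjoin_subring subA x) (@sub_adjoin _ _ subA x) h.
  exact: adjoin_id.
exists A; split=> //.
(* [1 + a A] consists of units, otherwise its inverses could be adjoined. *)
have unitA b : A b -> 1 + a * b != 0 /\ A (1 + a * b)^-1.
  move=> Ab; set s := 1 + a * b.
  have s0 : s != 0.
    apply/eqP => s0; apply: nA; suff -> : a^-1 = - b by exact: subringN.
    apply: (mulfI a0); rewrite divff // mulrN.
    by apply/eqP; rewrite -subr_eq0 opprK -/s s0.
  split=> //; apply: mem => /(adjoin_pspan) [n [u [Au e]]]; apply: nA.
  have sX m : exists2 b', A b' & s ^+ m = 1 + a * b'.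
    elim: m => [|m [b' Ab' IH]].
      by exists 0; [exact: subring0|rewrite mulr0 addr0].
    exists (b' + b + a * b * b'); last by rewrite exprS IH /s; ring.
    by do ![apply: subringD => // | apply: subringM => //].
  have As : A s by apply: subringD => //; [exact: subring1|exact: subringM].
  have [b' Ab' sn] := sX n.
  (* Multiplying by s ^ n clears the powers of s^-1, and s ^ n = 1 + a b' turns a^-1 s ^ n into a^-1
     + b'. *)
  have e2 : a^-1 * s ^+ n = \sum_(i < n.+1) u i * s ^+ (n - i).
    rewrite e mulr_suml; apply: eq_bigr => i _; rewrite -mulrA; congr (_ * _).
    by rewrite exprV_mul_expr // -ltnS.
  have -> : a^-1 = a^-1 * s ^+ n - b'.
    by rewrite sn mulrDr mulr1 mulrA mulVf // mul1r addrK.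
  apply: subringB => //; rewrite e2; apply: subring_sum => // i _.
  by apply: subringM => //; exact: subringX.
(* Multiply the expression in x^-1 by a and move the constant term across: the unit 1 - a v_0
   becomes a combination of negative powers of x. As m <= n, this writes x ^ n through lower powers,
   and the expression in x loses its top term. *)
have key n : forall m x, x != 0 -> (m <= n)%N -> pspan A n x a^-1 ->
    pspan A m x^-1 a^-1 -> (0 < n)%N /\ pspan A n.-1 x a^-1.
  case: n => [|n] m x x0 mn; first by move=> /(pspan0) /nA.
  move=> [u [Au eu]] [v [Av ev]]; split=> //=.
  have [c0 Ac] := unitA (- v 0%N) (subringN subA (Av 0%N)).
  set c := 1 + _ in c0 Ac.
  have ec : c = \sum_(i < m) a * v i.+1 * x^-1 ^+ i.+1.
    rewrite /c mulrN.
    have := congr1 ( *%R a) ev; rewrite divff // => ->.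
    rewrite big_ord_recl expr0 mulr1 mulrDr [a * v _ + _]addrC addrK mulr_sumr.
    by apply: eq_bigr => i _; rewrite mulrA.
  have xn : x ^+ n.+1 = \sum_(i < m) c^-1 * (a * v i.+1) * x ^+ (n - i).
    rewrite -[LHS]mul1r -(mulVf c0) {2}ec mulr_sumr mulr_suml.
    apply: eq_bigr => i _; rewrite !mulrA -[LHS]mulrA; congr (_ * _).
    by rewrite exprV_mul_expr ?subSS //; exact: leq_trans mn.
  rewrite eu big_ord_recr /=; apply: pspanD => //; first by exists u.
  rewrite xn mulr_sumr; apply: pspan_sum => // i _.
  rewrite mulrA; apply: pspan_scale => //; last exact: leq_subr.
  by do ![apply: subringM => //].
(* Descent on n + m, exchanging x and x^-1 so that the longer expression is the one reduced. *)
have no n : forall m x, x != 0 -> pspan A n x a^-1 ->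
    pspan A m x^-1 a^-1 -> False.
  move=> m; move: {2}(n + m)%N (leqnn (n + m)) => k; elim: k n m => [|k IH] n m.
    rewrite leqn0 addn_eq0 => /andP[/eqP -> _] x _ /pspan0 h _; exact: (nA h).
  move=> nmk x x0 h1 h2; have [mn|nm] := leqP m n.
    have [n0 h] := key _ _ _ x0 mn h1 h2.
    by apply: (IH n.-1 m _ x) => //; lia.
  have := key m n x^-1; rewrite invr_eq0 invrK => /(_ x0 (ltnW nm) h2 h1) [m0 h].
  by apply: (IH n m.-1 _ x) => //; lia.
move=> x; have [->|x0] := eqVneq x 0; first by left; exact: subring0.
apply: contrapT => /not_orP[nx nx'].
have /adjoin_pspan [n h1] : adjoin A x a^-1 by apply: contrapT => /mem.
have /adjoin_pspan [m h2] : adjoin A x^-1 a^-1 by apply: contrapT => /mem.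
exact: (no n m x).
Qed.

End Chevalley.

(** A valuation ring with p in its maximal ideal. No value group is formed: v(x) <= v(y) is
    expressed by [A (y / x)]. *)
Definition padic_valuation_ring (F : numFieldType) (p : nat) (A : set F) : Prop :=
  [/\ subring A, ~ A p%:R^-1 & forall x, A x \/ A x^-1].

Lemma padic_valuation_ring_exists (F : numFieldType) (p : nat) :
  prime p -> exists A : set F, padic_valuation_ring p A.
Proof.
move=> pp; pose B : set F := range (fun z : int => z%:~R).
have subB : subring B.
  split; first by exists 1.
    by move=> _ _ [x _ <-] [y _ <-]; exists (x - y) => //; rewrite rmorphB.
  by move=> _ _ [x _ <-] [y _ <-]; exists (x * y) => //; rewrite rmorphM.
have p0 : p%:R != 0 :> F by rewrite pnatr_eq0 -lt0n prime_gt0.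
have [||A [? _ ? ?]] := @chevalley_valuation_ring F B p%:R subB _ p0.
- by exists p%:Z.
- move=> [z _ zp].
  have : z * p%:Z = 1.
    by apply: (@intr_inj F); rewrite rmorphM /= zp mulVf.
  move=> /(congr1 absz); rewrite abszM /= => /eqP; rewrite muln_eq1 => /andP[_].
  by move/eqP => p1; rewrite p1 in pp.
- by exists A.
Qed.

Section UnitsOfSubring.
Variables (F : fieldType) (A : set F).
Hypothesis subA : subring A.

Definition subring_unit (x : F) : Prop := [/\ x != 0, A x & A x^-1].

Lemma subring_unit1 : subring_unit 1.
Proof. by split; rewrite ?oner_neq0 ?invr1 //; exact: subring1. Qed.

Lemma subring_unitM x y : subring_unit x -> subring_unit y -> subring_unit (x * y).
Proof.
move=> [x0 Ax Ax'] [y0 Ay Ay'].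
by split; rewrite ?mulf_neq0 ?invfM //; exact: subringM.
Qed.

Lemma subring_unitV x : subring_unit x -> subring_unit x^-1.
Proof. by move=> [x0 Ax Ax']; split; rewrite ?invr_eq0 ?invrK. Qed.

Lemma subring_unitX x n : subring_unit x -> subring_unit (x ^+ n).
Proof.
move=> ux; elim: n => [|n IH]; first by rewrite expr0; exact: subring_unit1.
by rewrite exprS; exact: subring_unitM.
Qed.

Lemma subring_unit_prod (I : Type) (r : seq I) (P : pred I) (f : I -> F) :
  (forall i, P i -> subring_unit (f i)) ->
  subring_unit (\prod_(i <- r | P i) f i).
Proof.
move=> uf; elim/big_ind: _ => //; first exact: subring_unit1.
exact: subring_unitM.
Qed.

End UnitsOfSubring.

(** * Valuations of integers and of algebraic numbers *)

Section PadicValuationRing.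
Variables (F : numFieldType) (p : nat) (A : set F).
Hypotheses (pp : prime p) (valA : padic_valuation_ring p A).

Let subA : subring A. Proof. by case: valA. Qed.
Let np : ~ A p%:R^-1. Proof. by case: valA. Qed.
Let totA x : A x \/ A x^-1. Proof. by case: valA. Qed.
Let p0 : p%:R != 0 :> F. Proof. by rewrite pnatr_eq0 -lt0n prime_gt0. Qed.

Lemma padic_bezout (c : int) : ~~ (p %| c)%Z ->
  exists u v : int, u%:~R * c%:~R + v%:~R * p%:R = 1 :> F.
Proof.
move=> pc; have : coprimez p c by rewrite coprimezE prime_coprime.
rewrite coprimez_sym => /coprimezP [[u v] /= e]; exists u, v.
have := congr1 (fun z : int => z%:~R : F) e.
by rewrite rmorphD !rmorphM /=.
Qed.

Lemma padic_int_over_p (c : int) : ~~ (p %| c)%Z -> ~ A (c%:~R / p%:R).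
Proof.
move=> /padic_bezout [u [v e]] Acp; apply: np.
have -> : p%:R^-1 = u%:~R * (c%:~R / p%:R) + v%:~R :> F.
  by apply: (mulIf p0); rewrite mulVf // mulrDl -!mulrA mulVf // mulr1 e.
apply: subringD => //; last exact: subring_int.
by apply: subringM => //; exact: subring_int.
Qed.

(** As c / p is not in A, its inverse p / c is; the relation u c + v p = 1 then gives 1 / c = u + v
    (p / c). *)
Lemma padic_unit_int (c : int) : ~~ (p %| c)%Z -> subring_unit A c%:~R.
Proof.
move=> pc; have c0 : c%:~R != 0 :> F.
  by rewrite intr_eq0; apply: contraNneq pc => ->; rewrite dvdz0.
split=> //; first exact: subring_int.
have [//|] := totA (c%:~R / p%:R); first by move/(padic_int_over_p pc).
rewrite invf_div => Apc; have [u [v e]] := padic_bezout pc.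
have -> : c%:~R^-1 = u%:~R + v%:~R * (p%:R / c%:~R) :> F.
  by apply: (mulIf c0); rewrite mulVf // mulrDl -!mulrA mulVf // mulr1 e.
apply: subringD => //; first exact: subring_int.
by apply: subringM => //; exact: subring_int.
Qed.

(** If p divided the denominator, the numerator n would be prime to p and some integer multiple of q
    would equal n / p, which is not in A. *)
Lemma padic_rat (q : rat) : A (ratr q) -> ~~ (p %| denq q)%Z.
Proof.
move=> Aq; apply/negP => /dvdzP [e de].
have e0 : e%:~R != 0 :> F.
  rewrite intr_eq0; apply: contraTneq (denq_neq0 q) => e0.
  by rewrite de e0 mul0r eqxx.
have pn : ~~ (p %| numq q)%Z.
  apply/negP => pn; have := coprime_num_den q.
  move: pn; rewrite dvdzE /= => pn co; have := coprime_dvdl pn co.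
  by rewrite prime_coprime // de abszM /= dvdn_mull.
apply: (padic_int_over_p pn).
have -> : (numq q)%:~R / p%:R = e%:~R * ratr q :> F.
  by rewrite /ratr de rmorphM /=; field; rewrite e0 p0.
by apply: subringM => //; exact: subring_int.
Qed.

(** The maximal ideal of A: when x^-1 is not in A, x is. *)
Definition nonunit x := x = 0 \/ ~ A x^-1.

(** One of x / y and y / x is in A. If u / v and (u + v)^-1 were both in A, so would be v^-1 = (u /
    v + 1) (u + v)^-1. *)
Lemma nonunitD x y : nonunit x -> nonunit y -> nonunit (x + y).
Proof.
have wl u v : v != 0 -> ~ A v^-1 -> A (u / v) -> nonunit (u + v).
  move=> v0 nv Auv; have [s0|s0] := eqVneq (u + v) 0; [by left|right=> Auv'].
  apply: nv; have -> : v^-1 = (u / v + 1) * (u + v)^-1.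
    by rewrite -[X in _ + X](divff v0) -mulrDl mulrAC divff // mul1r.
  by apply: subringM => //; apply: subringD => //; exact: subring1.
have [->|x0] := eqVneq x 0; first by rewrite add0r.
have [->|y0] := eqVneq y 0; first by rewrite addr0.
move=> [/eqP|nx]; first by rewrite (negPf x0).
move=> [/eqP|ny]; first by rewrite (negPf y0).
have [|h] := totA (x / y); first exact: wl.
by rewrite addrC; apply: wl; rewrite // -invf_div.
Qed.

Lemma nonunit_sum (I : Type) (r : seq I) (P : pred I) (f : I -> F) :
  (forall i, P i -> nonunit (f i)) -> nonunit (\sum_(i <- r | P i) f i).
Proof. by move=> h; elim/big_ind: _ => //; [left|exact: nonunitD]. Qed.

Lemma padic_min (s : seq F) : s != [::] -> (forall x, x \in s -> x != 0) ->
  exists2 x, x \in s & forall y, y \in s -> A (y / x).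
Proof.
elim: s => // a [_ _ h|b s IH _ h].
  exists a; rewrite ?mem_head // => y; rewrite inE => /eqP ->.
  by rewrite divff ?h ?mem_head //; exact: subring1.
have [//|x hx|x xs min] := IH.
  by apply: h; rewrite in_cons hx orbT.
have a0 : a != 0 by apply: h; rewrite mem_head.
have x0 : x != 0 by apply: h; rewrite in_cons xs orbT.
have [ax|xa] := totA (a / x).
  exists x => [|y]; first by rewrite in_cons xs orbT.
  rewrite in_cons => /orP[/eqP -> //|].
  exact: min.
exists a; rewrite ?mem_head // => y; rewrite in_cons => /orP[/eqP ->|ys].
  by rewrite divff //; exact: subring1.
have -> : y / a = (y / x) * (a / x)^-1 by rewrite invf_div mulrA mulfVK.
exact: subringM (min _ ys) xa.
Qed.

(* Two terms of least valuation must cancel in a vanishing sum. *)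
Lemma padic_sum0 (n : nat) (t : 'I_n -> F) : (exists i, t i != 0) ->
  \sum_i t i = 0 ->
  exists i j, [/\ i != j, t i != 0, t j != 0 & subring_unit A (t i / t j)].
Proof.
move=> [i0 ti0] sum0.
have [||x xs min] := @padic_min [seq t i | i <- enum 'I_n & t i != 0].
- apply/eqP => e; have : t i0 \in [seq t i | i <- enum 'I_n & t i != 0].
    by rewrite map_f // mem_filter ti0 mem_enum.
  by rewrite e.
- by move=> x /mapP [k]; rewrite mem_filter => /andP[tk _] ->.
move/mapP: xs => [j]; rewrite mem_filter => /andP[tj _] xtj.
have minj i : A (t i / t j).
  have [->|ti] := eqVneq (t i) 0; first by rewrite mul0r; exact: subring0.
  by rewrite -xtj; apply: min; rewrite map_f // mem_filter ti mem_enum.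
have [[i [ij ti u]]|none] :=
    pselect (exists i, [/\ i != j, t i != 0 & A (t i / t j)^-1]).
  by exists i, j; split=> //; split=> //; rewrite mulf_neq0 // invr_eq0.
(* All terms other than t j now have larger valuation, and dividing the sum by t j writes -1 as a
   sum of nonunits. *)
exfalso; have : nonunit (-1).
  have -> : -1 = \sum_(i | i != j) t i / t j.
    apply: (mulIf tj); rewrite mulr_suml (eq_bigr t) => [|i _]; last first.
      by rewrite mulfVK.
    move: sum0; rewrite (bigD1 j) //= => /eqP; rewrite addr_eq0 => /eqP ->.
    by rewrite mulN1r opprK.
  apply: nonunit_sum => i ij; have [ti|ti] := eqVneq (t i) 0.
    by left; rewrite ti mul0r.
  by right=> h; apply: none; exists i.
case; first by move/eqP; rewrite oppr_eq0 oner_eq0.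
by rewrite invrN invr1; apply; apply: subringN => //; exact: subring1.
Qed.

Lemma padic_int_decomp (c : int) : c != 0 ->
  exists k : nat, subring_unit A (c%:~R / p%:R ^+ k).
Proof.
move=> c0; have c0' : (0 < `|c|)%N by rewrite absz_gt0.
exists (logn p `|c|); have [m pm cm] := pfactor_coprime pp c0'.
have pX : p%:R ^+ logn p `|c| != 0 :> F by rewrite expf_neq0.
have -> : c%:~R / p%:R ^+ logn p `|c| = ((-1) ^+ (c < 0)%R * m%:Z)%:~R :> F.
  apply: (mulIf pX); rewrite mulfVK //.
  have -> : p%:R ^+ logn p `|c| = (p ^ logn p `|c|)%N%:~R :> F.
    by rewrite -natrX.
  by rewrite -rmorphM /= -mulrA -PoszM -cm -intEsign.
apply: padic_unit_int; rewrite dvdzE abszMsign.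
by rewrite -prime_coprime.
Qed.

(** Two terms q_i b^i and q_j b^j of the equation have the same valuation. Nonzero integers are
    powers of p up to units, hence so is b^(i - j). The bound on e lets one factorial serve as a
    common exponent. *)
Lemma padic_algebraic (q : {poly int}) (b : F) : q != 0 -> b != 0 ->
  root (map_poly intr q) b ->
  exists e : nat, exists k : int,
    [/\ (0 < e)%N, (e < size q)%N & subring_unit A (b ^+ e * p%:R ^ k)].
Proof.
move=> q0 b0; rewrite rootE.
have /(fun h => horner_coef_wide b h) -> :
    (size (map_poly (intr : int -> F) q) <= size q)%N.
  exact: size_poly.
move=> /eqP qb.
pose t (i : 'I_(size q)) : F := (q`_i)%:~R * b ^+ i.
have tE : \sum_i t i = 0.
  by rewrite -[RHS]qb; apply: eq_bigr => i _; rewrite coef_map.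
have [|i [j [ij ti tj u]]] := padic_sum0 _ tE.
  have lt : ((size q).-1 < size q)%N by rewrite prednK // lt0n size_poly_eq0.
  exists (Ordinal lt); rewrite mulf_neq0 ?expf_neq0 // intr_eq0 /=.
  by rewrite -lead_coefE lead_coef_eq0.
wlog ltij : i j ij ti tj u / (j < i)%N.
  move=> H; have [|ge] := ltnP j i; first exact: H.
  apply: (H j i) => //; first by rewrite eq_sym.
    by rewrite -invf_div; exact: subring_unitV.
  by rewrite ltn_neqAle ge andbT.
have qi0 : q`_i != 0.
  by apply: contraNneq ti => qi; rewrite /t qi mul0r.
have qj0 : q`_j != 0.
  by apply: contraNneq tj => qi; rewrite /t qi mul0r.
have [ki ui] := padic_int_decomp qi0; have [kj uj] := padic_int_decomp qj0.
exists (i - j)%N, (ki%:Z - kj%:Z); split; rewrite ?subn_gt0 //.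
  by apply: leq_ltn_trans (leq_subr _ _) _.
have -> : b ^+ (i - j) * p%:R ^ (ki%:Z - kj%:Z) =
    (t i / t j) * ((q`_j)%:~R / p%:R ^+ kj) / ((q`_i)%:~R / p%:R ^+ ki).
  rewrite expfzDr // -invr_expz /= /t -!exprnP.
  have -> : b ^+ i = b ^+ (i - j) * b ^+ j by rewrite -exprD subnK // ltnW.
  have : b ^+ j != 0 by rewrite expf_neq0.
  have : p%:R ^+ ki != 0 :> F by rewrite expf_neq0.
  have : p%:R ^+ kj != 0 :> F by rewrite expf_neq0.
  have : (q`_i)%:~R != 0 :> F by rewrite intr_eq0.
  have : (q`_j)%:~R != 0 :> F by rewrite intr_eq0.
  move=> h1 h2 h3 h4 h5; field.
  by rewrite h1 h2 h3 h4 h5.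
apply: subring_unitM => //; last exact: subring_unitV.
exact: subring_unitM.
Qed.

(** Otherwise b^-1 is in A, and dividing the equation by a power of b and by the leading
    coefficient, a unit, writes b as a polynomial in b^-1 over A. *)
Lemma padic_integral (q : {poly int}) (b : F) : q != 0 ->
  ~~ (p %| lead_coef q)%Z -> root (map_poly intr q) b -> A b.
Proof.
move=> q0 pl; rewrite rootE.
have /(fun h => horner_coef_wide b h) -> :
    (size (map_poly (intr : int -> F) q) <= size q)%N.
  exact: size_poly.
move=> /eqP qb.
have [//|Ab] := totA b.
have [->|b0] := eqVneq b 0; first exact: subring0.
move: qb; have : (0 < size q)%N by rewrite lt0n size_poly_eq0.
rewrite lead_coefE in pl; move: pl; case: (size q) => // n pl _.
rewrite big_ord_recr /= coef_map => /eqP; rewrite addr_eq0 => /eqP e.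
have [u0 _ Au] := padic_unit_int pl.
case: n e pl u0 Au => [|n] e pl u0 Au.
  move: e; rewrite big_ord0 expr0 mulr1 => /esym/eqP.
  by rewrite oppr_eq0 (negPf u0).
have -> : b = - ((q`_n.+1)%:~R^-1 * \sum_(i < n.+1) (q`_i)%:~R * b^-1 ^+ (n - i)).
  apply: (mulfI u0); rewrite mulrN mulrA mulfV // mul1r.
  have bn : b ^+ n != 0 by rewrite expf_neq0.
  apply: (mulIf bn); rewrite -mulrA -exprS mulNr -[LHS]opprK -e mulr_suml.
  congr (- _); apply: eq_bigr => i _; rewrite coef_map /= -mulrA; congr (_ * _).
  have ilen : (i <= n)%N by rewrite -ltnS.
  by rewrite exprV_mul_expr ?leq_subr // subKn.
apply: subringN => //; apply: subringM => //; apply: subring_sum => // i _.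
apply: subringM => //; first exact: subring_int.
exact: subringX.
Qed.

End PadicValuationRing.

Lemma rat_int_of_padic (F : numFieldType) (A : nat -> set F) (q : rat) :
  (forall p, prime p -> padic_valuation_ring p (A p)) ->
  (forall p, prime p -> A p (ratr q)) -> q \is a Num.int.
Proof.
move=> hA Aq; rewrite Qint_def; have : denq q = `|denq q|%N by rewrite gez0_abs.
have [n1|n1|n1] := ltngtP `|denq q|%N 1.
- by move: n1; rewrite ltnS leqn0 absz_eq0 (negPf (denq_neq0 q)).
- have pp := pdiv_prime n1; have := padic_rat pp (hA _ pp) (Aq _ pp).
  by rewrite dvdzE /= pdiv_dvd.
- by move=> ->; rewrite n1.
Qed.

(** With q = h X + q_0, the product h(b) b is the unit - q_0, while b and h(b) lie in A by
    integrality. *)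
Lemma padic_unit_root (F : numFieldType) (p : nat) (A : set F)
    (q : {poly int}) (b : F) : prime p -> padic_valuation_ring p A -> q != 0 ->
  ~~ (p %| lead_coef q)%Z -> ~~ (p %| q`_0)%Z -> root (map_poly intr q) b ->
  subring_unit A b.
Proof.
move=> pp hA q0 pl pc qb; have [subA _ _] := hA.
have Ab := padic_integral pp hA q0 pl qb.
have [c0 _ Ac] := padic_unit_int pp hA pc.
pose h : {poly int} := \poly_(i < size q) q`_i.+1.
have qE : q = h * 'X + (q`_0)%:P.
  apply/polyP => -[|i]; rewrite coefD coefMX coefC /= ?add0r // addr0 coef_poly.
  by case: ltnP => // le; rewrite nth_default // leqW.
have e : (map_poly intr h).[b] * b = - (q`_0)%:~R.
  move/rootP: qb; rewrite {1}qE rmorphD rmorphM /= map_polyX map_polyC !hornerE /=.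
  by move/eqP; rewrite addr_eq0 => /eqP.
have b0 : b != 0.
  apply: contraNneq c0 => b0; move: e; rewrite b0 mulr0 => /esym/eqP.
  by rewrite oppr_eq0.
split=> //.
have -> : b^-1 = - ((q`_0)%:~R^-1 * (map_poly intr h).[b]).
  by apply: (mulIf b0); rewrite mulVf // mulNr -mulrA e mulrN opprK mulVf.
apply: subringN => //; apply: subringM => //.
rewrite horner_coef; apply: subring_sum => // i _; apply: subringM => //.
  by rewrite coef_map; exact: subring_int.
exact: subringX.
Qed.

(** * Polynomials whose roots are values at the roots of another one *)

Lemma mulmx_horner_mx (F : fieldType) (n : nat) (A : 'M[F]_n.+1) (v : 'rV_n.+1)
    (r : F) (h : {poly F}) :
  v *m A = r *: v -> v *m horner_mx A h = h.[r] *: v.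
Proof.
move=> vA; elim/poly_ind: h => [|h c IH].
  by rewrite rmorph0 mulmx0 horner0 scale0r.
rewrite rmorphD rmorphM /= horner_mx_X horner_mx_C mulmxDr mulmxA IH.
rewrite -scalemxAl vA scalerA mul_mx_scalar -scalerDl.
by rewrite hornerD hornerM hornerX hornerC.
Qed.

(** Spectral mapping. If z is not a value of h at an eigenvalue, h - z is coprime to the
    characteristic polynomial, so by Bezout and Cayley-Hamilton h(A) - z is invertible. *)
Lemma root_char_poly_horner_mx (F : closedFieldType) (n : nat)
    (A : 'M[F]_n.+1) (h : {poly F}) (z : F) :
  root (char_poly (horner_mx A h)) z <->
  exists2 r, root (char_poly A) r & z = h.[r].
Proof.
split=> [|[r]]; rewrite -!eigenvalue_root_char; last first.
  move/eigenvalueP => [v vA v0] ->; apply/eigenvalueP; exists v => //.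
  exact: mulmx_horner_mx.
move/eigenvalueP => [v vh v0]; apply: contrapT => none.
have /Pdiv.ClosedField.coprimepP : forall r, root (char_poly A) r ->
    (h - z%:P).[r] != 0.
  move=> r rA; rewrite !hornerE subr_eq0; apply/negP => /eqP e.
  by apply: none; exists r.
move=> /Bezout_eq1_coprimepP [[s t] /= e].
rewrite [t * _]mulrC in e.
have := congr1 (horner_mx A) e.
rewrite rmorphD rmorphM /= Cayley_Hamilton mulr0 add0r rmorphM rmorphB rmorph1 /=.
rewrite horner_mx_C => e1.
have : v *m ((horner_mx A h - z%:M) * horner_mx A t) = v by rewrite e1 mulmx1.
rewrite mulmxA mulmxBr vh mul_mx_scalar subrr mul0mx => v0'.
by rewrite -v0' eqxx in v0.
Qed.

(** Modulo q the polynomial v has an inverse s, so u / v agrees with u s at the roots of q, and the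
    values of u s there are the eigenvalues of u s evaluated at the companion matrix. *)
Lemma rational_image_poly (F : numClosedFieldType) (q u v : {poly rat}) :
  q \is monic -> (1 < size q)%N ->
  (forall r : F, root (map_poly ratr q) r -> (map_poly ratr v).[r] != 0) ->
  exists X : {poly rat}, [/\ X \is monic, size X = size q &
    forall z : F, root (map_poly ratr X) z <->
      exists2 r, root (map_poly ratr q) r &
        z = (map_poly ratr u).[r] / (map_poly ratr v).[r]].
Proof.
move=> qm q1 /Pdiv.ClosedField.coprimepP.
rewrite coprimep_map => /Bezout_eq1_coprimepP [[t s] /= e].
have [m [A [cA]]] : exists m (A : 'M[rat]_m), char_poly A = q /\ m = (size q).-1.
  by exists (size q).-1, (companionmx q); rewrite companionmxK.
case: m A cA => [|m] A cA mE; first by move: q1 mE; case: (size q) => [|[]].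
pose X := char_poly (horner_mx A (u * s)).
exists X; split; first exact: char_poly_monic.
  by rewrite size_char_poly mE prednK // ltnW.
move=> z; rewrite /X map_char_poly map_horner_mx root_char_poly_horner_mx.
rewrite -map_char_poly cA.
have sv r : root (map_poly ratr q) r ->
    (map_poly ratr s).[r] = (map_poly ratr v).[r]^-1 :> F.
  move=> /rootP qr; have := congr1 (fun w => (map_poly ratr w : {poly F}).[r]) e.
  rewrite rmorphD !rmorphM rmorph1 /= hornerD !hornerM qr mulr0 add0r hornerC => sv1.
  by apply/esym/mulr1_eq; rewrite mulrC.
split=> [] [r qr ->]; exists r => //; by rewrite rmorphM hornerM sv.
Qed.

(** * Finiteness of bounded integral values *)

Lemma coef_prod_XsubC_subring (F : fieldType) (A : set F) (s : seq F) (i : nat) :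
  subring A -> (forall r, r \in s -> A r) -> A (\prod_(r <- s) ('X - r%:P))`_i.
Proof.
move=> subA; elim: s i => [|a s IH] i hs.
  by rewrite big_nil coef1; exact: subring_nat.
rewrite big_cons mulrBl coefB coefXM coefCM.
have As j : A (\prod_(r <- s) ('X - r%:P))`_j.
  by apply: IH => r rs; apply: hs; rewrite in_cons rs orbT.
apply: subringB => //; first by case: ifP => // _; exact: subring0.
by apply: subringM => //; apply: hs; rewrite mem_head.
Qed.

Lemma coef_prod_XsubC_norm (F : numFieldType) (b : F) (s : seq F) (i : nat) :
  0 <= b -> (forall r, r \in s -> `|r| <= b) ->
  `|(\prod_(r <- s) ('X - r%:P))`_i| <= (1 + b) ^+ size s.
Proof.
move=> b0; elim: s i => [|a s IH] i hs.
  by rewrite big_nil coef1 expr0; case: eqP => _; rewrite ?normr1 ?normr0.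
rewrite big_cons mulrBl coefB coefXM coefCM /= exprS mulrDl mul1r.
have bs j : `|(\prod_(r <- s) ('X - r%:P))`_j| <= (1 + b) ^+ size s.
  by apply: IH => r rs; apply: hs; rewrite in_cons rs orbT.
apply: le_trans (ler_normB _ _) _; apply: lerD.
  by case: ifP => // _; rewrite normr0 exprn_ge0 // addr_ge0.
by rewrite normrM; apply: ler_pM => //; apply: hs; rewrite mem_head.
Qed.

Lemma roots_of_bounded_int_poly (F : closedFieldType) (d K : nat) :
  exists s : seq F, forall q : {poly int}, map_poly intr q != 0 :> {poly F} ->
    (size q <= d)%N -> (forall i, (`|(q`_i)%R| <= K)%N) ->
    forall z : F, root (map_poly intr q) z -> z \in s.
Proof.
(* Coefficients are stored shifted by K, so that ['I_(2 * K).+1] stands for the range from -K to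
   K. *)
pose P (c : {ffun 'I_d -> 'I_(2 * K).+1}) : {poly int} :=
  \poly_(i < d) (if insub i is Some j then (c j)%:Z - K%:Z else 0).
exists (flatten [seq sval (closed_field_poly_normal (map_poly intr (P c) : {poly F}))
                | c <- enum {ffun 'I_d -> 'I_(2 * K).+1}]).
move=> q q0 qd qK z qz; apply/flatten_mapP.
pose c : {ffun 'I_d -> 'I_(2 * K).+1} :=
  [ffun i : 'I_d => inord `|(q`_i + K%:Z)%R|%N].
have PE : P c = q.
  apply/polyP => i; rewrite coef_poly; case: ltnP => id; last first.
    by rewrite nth_default // (leq_trans qd).
  rewrite insubT /= ffunE inordK.
    by have := qK i; rewrite /=; move: (q`_i) => a; lia.
  by have := qK i; rewrite ltnS /=; move: (q`_i) => a; lia.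
exists c; first by rewrite mem_enum.
rewrite PE; case: closed_field_poly_normal => s /= e.
move: qz; rewrite e rootZ ?lead_coef_eq0 ?root_prod_XsubC //.
Qed.

(** A finiteness result of Northcott's kind: s depends on g and b only, and not on the rings or on u
    and v. The quotients at all the roots are the roots of one monic rational polynomial, whose
    coefficients are integral at every prime and bounded. *)
Lemma integral_quotients_finite (F : numClosedFieldType) (g : {poly int}) :
  (1 < size g)%N -> forall b : nat,
  exists s : seq F, forall (A : nat -> set F) (u v : {poly rat}),
    (forall p, prime p -> padic_valuation_ring p (A p)) ->
    (forall r : F, root (map_poly intr g) r ->
       [/\ (map_poly ratr v).[r] != 0,
           forall p, prime p -> A p ((map_poly ratr u).[r] / (map_poly ratr v).[r]) &
           `|(map_poly ratr u).[r] / (map_poly ratr v).[r]| <= b%:R]) ->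
    forall r : F, root (map_poly intr g) r ->
      (map_poly ratr u).[r] / (map_poly ratr v).[r] \in s.
Proof.
move=> g1 b.
(* (1 + b) ^ d bounds the coefficients of a product of d = [(size g).-1] factors X - z with |z| <=
   b. *)
have [s hs] := roots_of_bounded_int_poly F (size g) (b.+1 ^ (size g).-1).
exists s => A u v hA huv r gr.
pose g' : {poly rat} := map_poly intr g.
have g0 : g != 0 by rewrite -size_poly_gt0 ltnW.
have sg' : size g' = size g by rewrite size_map_inj_poly //; exact: intr_inj.
have l0 : lead_coef g' != 0 by rewrite lead_coef_eq0 -size_poly_gt0 sg' ltnW.
pose q := (lead_coef g')^-1 *: g'.
have qm : q \is monic by rewrite monicE lead_coefZ mulVf.
have sq : size q = size g by rewrite size_scale ?invr_eq0.
have rq (z : F) : root (map_poly ratr q) z = root (map_poly intr g) z.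
  rewrite /q map_polyZ rootZ ?fmorph_eq0 ?invr_eq0 // /g' -map_poly_comp.
  by congr (root _ _); apply: eq_map_poly => i /=; rewrite ratr_int.
have [||X [Xm sX rX]] := @rational_image_poly F q u v qm; first by rewrite sq.
  by move=> z; rewrite rq => /huv [].
have [t Xt] := closed_field_poly_normal (map_poly ratr X : {poly F}).
have lX : lead_coef (map_poly ratr X : {poly F}) = 1.
  by apply/eqP; rewrite -monicE map_monic.
rewrite lX scale1r in Xt.
(* The multiplicities in t are not known, but integrality and size of the coefficients only need
   that each entry of t is a quotient. *)
have tX z : z \in t -> root (map_poly ratr X) z by rewrite Xt root_prod_XsubC.
have st : size t = (size g).-1.
  have := congr1 (fun w : {poly F} => size w) Xt.
  by rewrite size_map_poly sX sq size_prod_XsubC => ->.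
have Xint i : X`_i \is a Num.int.
  apply: (rat_int_of_padic hA) => p pp; rewrite -coef_map Xt.
  apply: coef_prod_XsubC_subring; first by case: (hA p pp).
  move=> z /tX /rX [r']; rewrite rq => /huv [_ + _] ->; exact.
have Xb i : `|X`_i| <= b.+1%:R ^+ (size g).-1.
  rewrite -(ler_rat F) ratr_norm rmorphXn /= ratr_nat -coef_map Xt.
  rewrite -st (_ : b.+1%:R = 1 + b%:R :> F); last by rewrite -natr1 addrC.
  apply: coef_prod_XsubC_norm; first exact: ler0n.
  by move=> z /tX /rX [r']; rewrite rq => /huv [_ _ +] ->.
pose Y : {poly int} := map_poly (fun x => Num.floor x) X.
have XY : X = map_poly intr Y.
  apply/polyP => i; rewrite coef_map /= coef_map_id0 ?floor0 //.
  by rewrite floorK.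
have XYF : map_poly ratr X = map_poly intr Y :> {poly F}.
  by rewrite XY -map_poly_comp; apply: eq_map_poly => i /=; rewrite ratr_int.
apply: (hs Y).
- by rewrite -XYF Xt monic_neq0 // monic_prod_XsubC.
- by rewrite -sq -sX XY [leqRHS]size_map_inj_poly //; exact: intr_inj.
- move=> i; have := Xb i; rewrite XY coef_map /= -intr_norm -natrX.
  by rewrite [leRHS]pmulrn ler_int; move: (b.+1 ^ _)%N (Y`_i) => m a; lia.
- by rewrite -XYF; apply/rX; exists r; rewrite ?rq.
Qed.

(** * Multiplicative dependence *)

Lemma pigeonhole_fiber (S T : finType) (c : S -> T) (M : nat) :
  (M * #|T| < #|S|)%N -> exists t, (M < #|[set x | c x == t]%SET|)%N.
Proof.
move=> lt; apply/existsP; apply: contraLR lt; rewrite negb_exists => /forallP h.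
rewrite -leqNgt -sum1_card (partition_big c predT) //= mulnC -sum_nat_const.
apply: leq_sum => t _; rewrite sum1_card.
by have := h t; rewrite -leqNgt cardsE.
Qed.

Lemma truncn_eq_dist (R : archiRealFieldType) (a b : R) : 0 <= a -> 0 <= b ->
  Num.truncn a = Num.truncn b -> `|a - b| < 1.
Proof.
move=> /truncn_itv /andP[a1 a2] /truncn_itv /andP[b1 b2] e.
move: b1 b2; rewrite -e -natr1 => b1 b2; move: a2; rewrite -natr1 => a2.
by rewrite ltr_norml; apply/andP; split; lra.
Qed.

(** The (H + 1) ^ N vectors f fall into O(H) ^ #|J| unit cells, so for N > #|J| and large H some
    cell receives more than M of them. In an integral coordinate, distance below 1 means
    equality. *)
Lemma box_pigeonhole (R : archiRealFieldType) (J : finType) (N : nat)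
    (w : 'I_N -> J -> R) (M : nat) : (#|J| < N)%N ->
  exists (H : nat) (X : {set {ffun 'I_N -> 'I_H.+1}}),
    (M < #|X|)%N /\ forall f g, f \in X -> g \in X -> forall j,
      `|\sum_n (f n)%:R * w n j - \sum_n (g n)%:R * w n j| < 1.
Proof.
move=> JN.
pose W := (\sum_(j : J) \sum_n (Num.truncn `|w n j|).+1)%N.
have wW j : \sum_n `|w n j| <= W%:R.
  rewrite /W (bigD1 j) //= natrD; apply: ler_wpDr; first exact: ler0n.
  rewrite natr_sum; apply: ler_sum => n _; exact/ltW/truncnS_gt.
(* Each coordinate meets at most 2 H W + 1 <= C (H + 1) cells, and M C ^ #|J| < H + 1. *)
pose C := (2 * W).+1; pose H := (M * C ^ #|J|)%N.
pose S := {ffun 'I_N -> 'I_H.+1}.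
pose v (f : S) (j : J) : R := \sum_n (f n)%:R * w n j.
have vb f j : `|v f j| <= (H * W)%:R.
  apply: le_trans (ler_norm_sum _ _ _) _.
  rewrite natrM; apply: (@le_trans _ _ (\sum_n H%:R * `|w n j|)).
    apply: ler_sum => n _; rewrite normrM ler_wpM2r // normr_nat ler_nat.
    by rewrite -ltnS.
  by rewrite -mulr_sumr ler_wpM2l ?ler0n.
have v0 f j : 0 <= v f j + (H * W)%:R.
  by have := vb f j; rewrite ler_norml => /andP[? _]; lra.
pose c (f : S) : {ffun J -> 'I_(2 * (H * W)).+1} :=
  [ffun j => inord (Num.truncn (v f j + (H * W)%:R))].
have [|t ht] := @pigeonhole_fiber _ _ c M.
  rewrite !card_ffun !card_ord.
  apply: (@leq_ltn_trans (M * (C * H.+1) ^ #|J|)%N).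
    rewrite leq_mul2l; have [->|J0] := posnP #|J|; first by rewrite !expn0 orbT.
    by rewrite leq_exp2r // /C; apply/orP; right; nia.
  rewrite expnMn mulnA -/H; apply: (@leq_trans (H.+1 ^ #|J|.+1)).
    by rewrite expnS ltn_pmul2r // expn_gt0.
  by rewrite leq_pexp2l.
exists H, [set x | c x == t]%SET; split=> // f g; rewrite !inE => /eqP cf /eqP cg j.
have -> : \sum_n (f n)%:R * w n j - \sum_n (g n)%:R * w n j =
   (v f j + (H * W)%:R) - (v g j + (H * W)%:R) by rewrite /v; ring.
apply: truncn_eq_dist => //.
have lt h : (Num.truncn (v h j + (H * W)%:R) < (2 * (H * W)).+1)%N.
  rewrite ltnS -(ler_nat R); apply: le_trans (_ : v h j + (H * W)%:R <= _).
    by rewrite truncn_le.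
  have := vb h j; rewrite ler_norml natrM => /andP[_]; lra.
have := congr1 (fun h : {ffun _ -> _} => val (h j)) (etrans cf (esym cg)).
by rewrite !ffunE /= !inordK.
Qed.

(** * Moduli of complex numbers *)

Section ComplexModulus.
Variable R : realType.
Implicit Types z w : R[i].

(** The norm of [R[i]] takes values in [R[i]]; its real part is a number to which [ln] applies. *)
Definition modulus z : R := complex.Re `|z|.

Lemma modulusE z : (modulus z)%:C = `|z|.
Proof. by rewrite /modulus normc_def. Qed.

Lemma modulus_gt0 z : z != 0 -> 0 < modulus z.
Proof. by rewrite -normr_gt0 -modulusE ltcR. Qed.

Lemma modulusM z w : modulus (z * w) = modulus z * modulus w.
Proof.
by apply: (@complexI R); rewrite rmorphM /= !modulusE normrM.
Qed.

Lemma modulus1 : modulus 1 = 1.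
Proof. by rewrite /modulus normr1. Qed.

Lemma ln_modulus_prod (N : nat) (z : 'I_N -> R[i]) (e : 'I_N -> nat) :
  (forall n, z n != 0) ->
  ln (modulus (\prod_n z n ^+ e n)) = \sum_n (e n)%:R * ln (modulus (z n)).
Proof.
move=> z0.
suff [] : \prod_n z n ^+ e n != 0 /\
  ln (modulus (\prod_n z n ^+ e n)) = \sum_n (e n)%:R * ln (modulus (z n)) by [].
elim/big_rec2: _ => [|n a b _ [b0 IH]].
  by rewrite oner_neq0 modulus1 ln1.
have zn : z n ^+ e n != 0 by rewrite expf_neq0.
split; first by rewrite mulf_neq0.
rewrite modulusM lnM ?posrE ?modulus_gt0 // IH; congr (_ + _).
elim: (e n) => [|k IHk]; first by rewrite expr0 modulus1 ln1 mul0r.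
rewrite exprS modulusM lnM ?posrE ?modulus_gt0 ?expf_neq0 // IHk.
by rewrite -natr1; ring.
Qed.

Lemma norm_quotient_le z w : z != 0 -> w != 0 ->
  `|ln (modulus z) - ln (modulus w)| < 1 ->
  `|z / w| <= (Num.truncn (expR 1 : R)).+1%:R.
Proof.
move=> z0 w0 /ltr_normlW h.
have zE : z = (z / w) * w by rewrite mulfVK.
have q0 : z / w != 0 by rewrite mulf_neq0 // invr_eq0.
move: h; rewrite {1}zE modulusM lnM ?posrE ?modulus_gt0 // addrK => h.
rewrite -modulusE -(rmorph_nat (real_complex R)) lecR.
apply: le_trans (ltW (truncnS_gt _)).
by rewrite -[leLHS]lnK ?posrE ?modulus_gt0 // ler_expR ltW.
Qed.

End ComplexModulus.

Lemma size_comp_XsubC (g : {poly int}) (c : int) : size (g \Po ('X - c%:P)) = size g.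
Proof. by rewrite size_comp_poly2 // size_XsubC. Qed.

(** * A multiplicative relation from smooth values *)

Section SmoothTranslates.
Variables (R : realType) (g : {poly int}) (alpha : R[i]) (S : seq nat).
Variables (N : nat) (x : 'I_N -> nat).
Let d := (size g).-1.
Hypotheses (g1 : (1 < size g)%N) (galpha : root (map_poly intr g) alpha).
Hypothesis x_inj : injective x.
Hypothesis Sprime : forall p, p \in S -> prime p.
Hypothesis Slead : forall p, prime p -> (p %| lead_coef g)%Z -> p \in S.
Hypothesis Svalue : forall n p, prime p -> (p %| g.[- (x n)%:Z])%Z -> p \in S.
Hypothesis value0 : forall n, g.[- (x n)%:Z] != 0.
Hypothesis ltN : (d * size S + d < N)%N.

Let y n (r : R[i]) : R[i] := (x n)%:R + r.
(** The translates [y n r] are roots of [gx n], whose leading coefficient is that of g and whose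
    constant term is g(- x n). A prime outside S divides neither. *)
Let gx n : {poly int} := g \Po ('X - (x n)%:Z%:P).

Let gx_neq0 n : gx n != 0.
Proof. by rewrite -size_poly_gt0 size_comp_XsubC ltnW. Qed.

Let gx_lead n : lead_coef (gx n) = lead_coef g.
Proof. by rewrite lead_coef_comp ?size_XsubC // lead_coefXsubC expr1n mulr1. Qed.

Let gx_coef0 n : (gx n)`_0 = g.[- (x n)%:Z].
Proof. by rewrite -horner_coef0 horner_comp !hornerE. Qed.

Let gx_root n r : root (map_poly intr g) r -> root (map_poly intr (gx n)) (y n r).
Proof.
move=> /rootP gr; apply/rootP; rewrite map_comp_poly horner_comp.
by rewrite rmorphB /= map_polyX map_polyC !hornerE /= /y addrC addKr.
Qed.

Let y_neq0 n r : root (map_poly intr g) r -> y n r != 0.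
Proof.
move=> /(gx_root n)/rootP e; apply/eqP => y0; move: e; rewrite y0 horner_coef0.
by rewrite coef_map gx_coef0 => /eqP; rewrite intr_eq0 (negPf (value0 n)).
Qed.

(** The exponent e of [padic_algebraic] is at most d and so divides d!, which therefore serves all
    n, r and p at once. *)
Let padic_exponent (A : set R[i]) p n r : prime p -> padic_valuation_ring p A ->
  root (map_poly intr g) r ->
  exists k : int, subring_unit A (y n r ^+ d`! * p%:R ^ k).
Proof.
move=> pp hA gr; have [subA _ _] := hA.
have [e [k [e0 ed u]]] :=
  padic_algebraic pp hA (gx_neq0 n) (y_neq0 n gr) (gx_root n gr).
rewrite size_comp_XsubC in ed.
have /dvdnP [m dm] : (e %| d`!)%N by rewrite dvdn_fact // e0 /d; lia.
exists (k * m%:Z); have := subring_unitX subA m u.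
by rewrite exprMn -exprM mulnC -dm -exprz_exp.
Qed.

(** A single rational polynomial yields the products at all roots of g simultaneously, as
    [integral_quotients_finite] requires. *)
Let monomial (f : 'I_N -> nat) : {poly rat} :=
  \prod_n ('X + (x n)%:R%:P) ^+ (d`! * f n).

Let monomialE f (r : R[i]) :
  (map_poly ratr (monomial f)).[r] = \prod_n y n r ^+ (d`! * f n).
Proof.
rewrite rmorph_prod horner_prod; apply: eq_bigr => n _.
rewrite rmorphXn /= rmorphD /= map_polyX map_polyC /= ratr_nat horner_exp !hornerE.
by rewrite /y addrC.
Qed.

Let monomial_neq0 f (r : R[i]) : root (map_poly intr g) r ->
  \prod_n y n r ^+ (d`! * f n) != 0.
Proof. by move=> gr; apply/prodf_neq0 => n _; rewrite expf_neq0 // y_neq0. Qed.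

Lemma smooth_translates_dependent :
  multiplicatively_dependent (nat_translate alpha).
Proof.
have /choice [A hA] p : exists A : set R[i], prime p -> padic_valuation_ring p A.
  have [pp|npp] := boolP (prime p); last by exists set0.
  by have [A hA] := padic_valuation_ring_exists (R[i] : numFieldType) pp; exists A.
have [rs rsE] := closed_field_poly_normal (map_poly intr g : {poly R[i]}).
have sg : size (map_poly intr g : {poly R[i]}) = size g.
  by rewrite size_map_inj_poly //; exact: intr_inj.
have l0 : lead_coef (map_poly intr g : {poly R[i]}) != 0.
  by rewrite lead_coef_eq0 -size_poly_gt0 sg ltnW.
have rsg r : (r \in rs) = root (map_poly intr g) r.
  by rewrite rsE rootZ // root_prod_XsubC.
have srs : size rs = d.
  have := congr1 (fun w : {poly R[i]} => size w) rsE.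
  by rewrite sg size_scale // size_prod_XsubC /d => ->.
have rsi (i : 'I_d) : root (map_poly intr g) rs`_i by rewrite -rsg mem_nth ?srs.
have Sj (j : 'I_(size S)) : prime (nth 0%N S j) by apply: Sprime; rewrite mem_nth.
have /choice [K hK] (t : 'I_N * ('I_d * 'I_(size S))) : exists k : int,
    subring_unit (A (nth 0%N S t.2.2))
      (y t.1 rs`_t.2.1 ^+ d`! * (nth 0%N S t.2.2)%:R ^ k).
  exact: padic_exponent (hA _ (Sj _)) (rsi _).
pose w n (j : ('I_d * 'I_(size S)) + 'I_d) : R :=
  match j with
  | inl ij => (K (n, ij))%:~R
  | inr i => d`!%:R * ln (modulus (y n rs`_i))
  end.
have [s hs] := integral_quotients_finite (R[i] : numClosedFieldType) g1
  (Num.truncn (expR 1 : R)).+1.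
have [|H [X [ltX hX]]] := @box_pigeonhole R _ N w (size s).
  by rewrite card_sum card_prod !card_ord.
have /card_gt0P [f0 f0X] : (0 < #|X|)%N by exact: leq_ltn_trans ltX.
pose u (f : {ffun 'I_N -> 'I_H.+1}) r := \prod_n y n r ^+ (d`! * f n).
have u0 f r : root (map_poly intr g) r -> u f r != 0.
  by move=> gr; exact: (@monomial_neq0 (fun n => f n)).
have us f : f \in X -> u f alpha / u f0 alpha \in s.
  have uE h r : u h r = (map_poly ratr (monomial (fun n => h n))).[r].
    by rewrite monomialE.
  move=> fX; rewrite !uE; apply: (hs A) => // r gr; rewrite -!uE.
  have /(nthP 0) [i ilt ri] : r \in rs by rewrite rsg.
  rewrite srs in ilt; split; first exact: u0.
    move=> p pp; have [subA _ _] := hA p pp; have [pS|pS] := boolP (p \in S).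
      have /(nthP 0%N) [j jlt pj] := pS.
      pose ij := (Ordinal ilt, Ordinal jlt).
      have p0 : p%:R != 0 :> R[i] by rewrite pnatr_eq0 -lt0n prime_gt0.
      pose k (f : {ffun 'I_N -> 'I_H.+1}) := \sum_n (f n)%:Z * K (n, ij).
      (* Both sides are integers, and f and f0 lie in the same cell. *)
      have kE : k f = k f0.
        have := hX f f0 fX f0X (inl ij) => /=.
        have kR (h : {ffun 'I_N -> 'I_H.+1}) :
            \sum_n (h n)%:R * (K (n, ij))%:~R = (k h)%:~R :> R.
          rewrite /k rmorph_sum /=; apply: eq_bigr => n _.
          by rewrite rmorphM /=.
        rewrite !kR -rmorphB -intr_norm -[1]/(1%:~R) ltr_int.
        by move: (k f) (k f0) => a b; lia.
      have uk h : subring_unit (A p) (u h r * p%:R ^ k h).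
        have -> : u h r * p%:R ^ k h =
            \prod_n (y n r ^+ d`! * p%:R ^ K (n, ij)) ^+ h n.
          rewrite /u /k; elim/big_rec3: _ => [|n a b c _ <-].
            by rewrite expr0z mulr1.
          rewrite expfzDr // exprMn -exprM [(h n)%:Z * _]mulrC -exprz_exp -exprnP.
          rewrite !mulrA; congr (_ * _); rewrite -!mulrA; congr (_ * _).
          by rewrite mulrC.
        apply: subring_unit_prod => // n _; apply: subring_unitX => //.
        by have := hK (n, ij); rewrite /= ri pj.
      (* The equal powers of p cancel in the quotient. *)
      have [_ + _] := subring_unitM subA (uk f) (subring_unitV (uk f0)).
      rewrite kE invfM mulrACA divff ?mulr1 //; by rewrite expfz_neq0.
    have un n : subring_unit (A p) (y n r).
      apply: (padic_unit_root pp (hA p pp) (gx_neq0 n)); last exact: gx_root.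
        by rewrite gx_lead; apply: contra pS; exact: Slead.
      by rewrite gx_coef0; apply: contra pS; exact: Svalue.
    have uu h : subring_unit (A p) (u h r).
      by apply: subring_unit_prod => // n _; exact: subring_unitX.
    by have [] := subring_unitM subA (uu f) (subring_unitV (uu f0)).
  apply: norm_quotient_le; rewrite ?u0 //.
  have := hX f f0 fX f0X (inr (Ordinal ilt)) => /=; rewrite ri.
  suff lnu (h : {ffun 'I_N -> 'I_H.+1}) :
      \sum_n (h n)%:R * (d`!%:R * ln (modulus (y n r))) = ln (modulus (u h r)).
    by rewrite !lnu.
  rewrite ln_modulus_prod => [|n]; last exact: y_neq0.
  by apply: eq_bigr => n _; rewrite natrM mulrCA mulrA.
(* X has more elements than s, so the map from f to u f / u f0 is not injective on X. *)
have [f [h [fh uE]]] : exists f h : {ffun 'I_N -> 'I_H.+1},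
    f != h /\ u f alpha = u h alpha.
  apply: contrapT => none; have := ltX; rewrite ltnNge => /negP; apply.
  rewrite cardE -(size_map (fun f => u f alpha / u f0 alpha)).
  apply: uniq_leq_size; last first.
    by move=> z /mapP [f]; rewrite mem_enum => fX ->; exact: us.
  rewrite map_inj_uniq ?enum_uniq // => f h e; apply/eqP.
  apply: contrapT => /negP fh; apply: none; exists f, h; split=> //.
  by apply: (mulIf (_ : (u f0 alpha)^-1 != 0)) => //; rewrite invr_eq0 u0.
exists N, (fun n => y n alpha), (fun n => d`!%:Z * ((f n)%:Z - (h n)%:Z)); split.
- by move=> m n /addIr /eqP; rewrite eqr_nat => /eqP /x_inj.
- by move=> n; exists (x n).
- apply: contrapT => none; move/negP: fh; apply; apply/eqP/ffunP => n.
  apply: contrapT => fhn; apply: none; exists n; apply/eqP.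
  rewrite mulf_neq0 //; first by rewrite eqz_nat -lt0n fact_gt0.
  by rewrite subr_eq0 eqz_nat; apply/negP => /eqP /val_inj.
- have -> : \prod_n y n alpha ^ (d`!%:Z * ((f n)%:Z - (h n)%:Z)) =
      u f alpha / u h alpha.
    rewrite /u -prodf_div; apply: eq_bigr => n _.
    rewrite mulrBr expfzDr ?y_neq0 // -invr_expz.
    by rewrite !exprnP !PoszM.
  by rewrite uE divff // u0.
Qed.

End SmoothTranslates.

(** * From smooth values to dependent translates *)

Theorem theorem3 (R : realType)
  (unbounded_Psi : forall P : {poly int}, (1 < size P)%N ->
    forall B : R, exists x y : R,
      [/\ 2 <= x, 2 <= y & B < (Psi P x y)%:R * ln y / y]) :
  (forall alpha : R[i], algebraic_number alpha ->
     multiplicatively_dependent (nat_translate alpha)) /\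
  ~ (exists alpha : R[i], algebraic_number alpha /\
       multiplicatively_independent (nat_translate alpha)).
Proof.
suff dependent (alpha : R[i]) : algebraic_number alpha ->
    multiplicatively_dependent (nat_translate alpha).
  by split=> // -[alpha [/dependent]].
move=> [g0 g0_neq0 g0_root].
have [g [a a0 gE]] := rat_poly_scale g0.
have galpha : root (map_poly intr g) alpha.
  move: g0_root; rewrite gE map_polyZ rootZ; last first.
    by rewrite fmorph_eq0 invr_eq0 intr_eq0.
  rewrite -map_poly_comp; congr (root _ _).
  by apply: eq_map_poly => i /=; rewrite ratr_int.
have g_neq0 : g != 0.
  by apply: contraNneq g0_neq0 => g0'; rewrite gE g0' map_poly0 scaler0.
have g1 : (1 < size g)%N.
  rewrite ltnNge; apply/negP => /size1_polyC gC; move: galpha g_neq0.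
  by rewrite gC map_polyC rootC /= intr_eq0 polyC_eq0 => ->.
(* Up to sign, g(- n) is the leading coefficient times the product of the n + r over the roots r;
   hence the change of sign. *)
pose P := g \Po (- 'X).
have sP : size P = size g by rewrite size_comp_poly2 // size_polyN size_polyX.
have PE n : P.[n] = g.[- n] by rewrite horner_comp hornerN hornerX.
pose d := (size g).-1.
pose L := primes `|lead_coef g|.
(* By Chebyshev the primes up to y, taken d times, contribute at most d (2 + 2 ln 8) y after
   multiplication by ln y; for the rest ln y <= y suffices. *)
pose B : R := d%:R * (2 + 2 * ln 8) + (d * size L + d)%:R.
have [|x [y [x2 y2 hB]]] := unbounded_Psi P _ B; first by rewrite sP.
pose Y := [seq p <- iota 0 (Num.truncn y).+1 | prime p].
pose S := Y ++ L.
have y0 : 0 < y by lra.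
have psi_large : (d * size S + d < Psi P x y)%N.
  rewrite ltnNge; apply/negP => small; move: hB; rewrite ltNge => /negP; apply.
  rewrite ler_pdivrMr //.
  have sE : size S = (prime_count (Num.truncn y) + size L)%N.
    by rewrite size_cat size_filter.
  have ly : ln y <= y := ltW (ln_sublinear y0).
  have ln0 : 0 <= ln y by apply: ln_ge0; lra.
  apply: (@le_trans _ _ ((d * size S + d)%:R * ln y)).
    by rewrite ler_wpM2r // ler_nat.
  rewrite sE mulnDr -addnA natrD [in leLHS]mulrDl /B mulrDl; apply: lerD.
    rewrite natrM -!mulrA; apply: ler_wpM2l; first exact: ler0n.
    exact: chebyshev_upper.
  by apply: ler_wpM2l.
pose V := fset_set (smooth_values P x y).
(* [Psi] counts values rather than arguments, so one argument is chosen for each value; distinct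
   values make the arguments distinct. *)
have mem_V (j : 'I_(Psi P x y)) : exists n : nat,
    P.[n%:Z] = nth 0 V j /\ smooth y P.[n%:Z].
  have : nth 0 V j \in V by rewrite mem_nth.
  rewrite in_fset_set; last exact: finite_smooth_values.
  by rewrite inE => -[[n _ <-] ?]; exists n.
have [t ht] := choice mem_V.
apply: (@smooth_translates_dependent R g alpha S (Psi P x y) t) => //.
- move=> i j tij; apply/val_inj/eqP.
  rewrite -(nth_uniq 0 (ltn_ord i) (ltn_ord j) (fset_uniq V)).
  by rewrite -(ht i).1 -(ht j).1 tij.
- by move=> p; rewrite mem_cat mem_filter mem_primes => /orP[/andP[]|/andP[]].
- move=> p pp; rewrite dvdzE /= mem_cat mem_primes pp absz_gt0 lead_coef_eq0.
  by rewrite g_neq0 /= => ->; rewrite orbT.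
- move=> n p pp; rewrite -PE => pP; have := (ht n).2 p pp pP.
  rewrite mem_cat mem_filter pp mem_iota /= add0n ltnS => py.
  by rewrite truncn_ge_nat ?py // ltW.
- move=> n; apply/eqP => gn0.
  have := (ht n).2; rewrite PE gn0 => smooth0.
  have [p py pp] := prime_above (Num.truncn y).
  have := smooth0 p pp (dvdz0 _); rewrite -truncn_ge_nat ?(ltW y0) //.
  by rewrite leqNgt py.
Qed.
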